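(* Let $G_1=(V,E_1)$ and $G_2=(V,E_2)$ be graphs on the same finite vertex set $V$ whose adjacency matrices $A_1,A_2$ belong to an association scheme $\mathcal{S}=\{I,A_1,A_2,\dots,A_d\}$ with first eigenmatrix $P$, and let $k_1,k_2$ be the degrees of the regular graphs $G_1,G_2$. Then $$\gamma(G_1,G_2)=\frac{|V|}{2}\left((k_1+k_2)+\max_{0\le l\le d}\{P_{l2}-P_{l1}\}\right).$$
   Context: Graphs are finite, simple, undirected and loopless. For $G_1=(V,E_1)$, $G_2=(V,E_2)$, let $L=\sum_{ij\in E_1}(e_i-e_j)(e_i-e_j)^T$ be the Laplacian matrix of $G_1$ and $K=\sum_{ij\in E_2}(e_i+e_j)(e_i+e_j)^T$ the signless Laplacian matrix of $G_2$. With $\langle X,Y\rangle=\operatorname{tr}(XY^T)$, $M\succcurlyeq0$ meaning real symmetric positive semidefinite, $\mathrm{diag}(M)$ the vector of diagonal entries and $\mathbb{1}$ the all-ones vector, define $$\gamma(G_1,G_2)=\max\left\{\left\langle\tfrac{L+K}{2},M\right\rangle : M\succcurlyeq0,\ \mathrm{diag}(M)=\mathbb{1}\right\}.$$ An association scheme is a set $\{A_0,A_1,\dots,A_d\}$ of nonzero symmetric square matrices with entries in $\{0,1\}$ (indexed here by $V$) such that: (1) $\sum_iA_i=J$, the all-ones matrix; (2) any $A_i$ with a nonzero diagonal entry is a diagonal matrix; (3) there are nonnegative integers $p_{ij}^l$ with $A_iA_j=\sum_{l=0}^dp_{ij}^lA_l$ for all $i,j$. These conditions imply that the matrices commute and that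 the identity is one of them; we take $A_0=I$. The span of the $A_i$ has a basis of primitive idempotents $E_0=\frac1{|V|}J,E_1,\dots,E_d$ (the orthogonal projectors onto the common eigenspaces). The first eigenmatrix $P\in M_{d+1}(\mathbb{R})$, with rows and columns indexed by $0,\dots,d$, is defined by $A_i=\sum_{l=0}^dP_{li}E_l$. Each $A_i$ with $i\ge1$ is the adjacency matrix of a regular graph, of degree $k_i=P_{0i}$. *)

(* Defs.v *)
From HB Require Import structures.
From mathcomp Require Import all_boot all_order all_algebra.
From mathcomp Require Import all_classical all_reals.

Set Implicit Arguments.
Unset Strict Implicit.
Unset Printing Implicit Defensive.

Import Order.TTheory GRing.Theory Num.Theory.
Local Open Scope ring_scope.

Record sgraph (V : finType) := SGraph {
  adj :> rel V;
  adj_sym : symmetric adj;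
  adj_irr : irreflexive adj
}.

Definition regular (V : finType) (G : sgraph V) (k : nat) : Prop :=
  forall v : V, #|[pred w | G v w]| = k.

(* Matrices indexed by V are matrices of size #|V|, the vertex v being the
   index [enum_rank v]. *)
Definition adjmx (R : realType) (V : finType) (G : sgraph V) : 'M[R]_#|V| :=
  \matrix_(i, j) (G (enum_val i) (enum_val j))%:R.

Definition evec (R : realType) (V : finType) (v : V) : 'cV[R]_#|V| :=
  delta_mx (enum_rank v) 0.

(* Both sums below run over unordered edges: each edge is represented by its
   unique orientation that is increasing for [enum_rank]. *)
Definition laplacian (R : realType) (V : finType) (G : sgraph V) : 'M[R]_#|V| :=
  \sum_(p : V * V | G p.1 p.2 && (enum_rank p.1 < enum_rank p.2)%N)
    (evec R p.1 - evec R p.2) *m (evec R p.1 - evec R p.2)^T.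

Definition signless_laplacian (R : realType) (V : finType) (G : sgraph V) :
    'M[R]_#|V| :=
  \sum_(p : V * V | G p.1 p.2 && (enum_rank p.1 < enum_rank p.2)%N)
    (evec R p.1 + evec R p.2) *m (evec R p.1 + evec R p.2)^T.

Definition mxinner (R : realType) (n : nat) (X Y : 'M[R]_n) : R :=
  \tr (X *m Y^T).

Definition psd (R : realType) (n : nat) (M : 'M[R]_n) : Prop :=
  M^T = M /\ forall x : 'cV[R]_n, 0 <= (x^T *m M *m x) 0 0.

Definition gamma_values (R : realType) (V : finType) (G1 G2 : sgraph V) :
    set R :=
  [set g | exists M : 'M[R]_#|V|,
    [/\ psd M, (forall i, M i i = 1) &
        g = mxinner (2^-1 *: (laplacian R G1 + signless_laplacian R G2)) M]]%classic.

Definition is_max (R : realType) (S : set R) (m : R) : Prop :=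
  S m /\ forall s, S s -> s <= m.

(* [sup] makes this total; that it is an actual maximum is the assertion
   [is_max (gamma_values G1 G2) (gamma R G1 G2)]. *)
Definition gamma (R : realType) (V : finType) (G1 G2 : sgraph V) : R :=
  sup (gamma_values (R := R) G1 G2).

(* The A i are pairwise distinct: they are nonzero, and by the sum condition
   their supports are disjoint. *)
Record assoc_scheme (R : realType) (n d : nat) (A : 'I_d.+1 -> 'M[R]_n) :
    Prop := AssocScheme {
  scheme_neq0 : forall i, A i != 0;
  scheme_sym : forall i, (A i)^T = A i;
  scheme_01 : forall i x y, A i x y = 0 \/ A i x y = 1;
  scheme_sum : \sum_i A i = const_mx 1;
  scheme_diag : forall i x, A i x x != 0 -> is_diag_mx (A i);
  scheme_mul : exists p : 'I_d.+1 -> 'I_d.+1 -> 'I_d.+1 -> nat,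
    forall i j, A i *m A j = \sum_l (p i j l)%:R *: A l;
  scheme_id : A ord0 = 1%:M
}.

Definition scheme_span (R : realType) (n d : nat) (A : 'I_d.+1 -> 'M[R]_n) :
    {vspace 'M[R]_n} :=
  <<[seq A i | i : 'I_d.+1]>>%VS.

Definition idempotent_in (R : realType) (n : nat) (U : {vspace 'M[R]_n})
    (e : 'M[R]_n) : Prop :=
  e \in U /\ e *m e = e.

Definition primitive_idempotent (R : realType) (n : nat)
    (U : {vspace 'M[R]_n}) (e : 'M[R]_n) : Prop :=
  [/\ idempotent_in U e, e != 0 &
      forall f g, idempotent_in U f -> idempotent_in U g ->
        f *m g = 0 -> g *m f = 0 -> e = f + g -> f = 0 \/ g = 0].

Definition idempotent_basis (R : realType) (n d : nat)
    (A E : 'I_d.+1 -> 'M[R]_n) : Prop :=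
  [/\ basis_of (scheme_span A) [seq E l | l : 'I_d.+1],
      (forall l, primitive_idempotent (scheme_span A) (E l)) &
      E ord0 = n%:R^-1 *: const_mx 1].

Definition first_eigenmatrix (R : realType) (n d : nat)
    (A E : 'I_d.+1 -> 'M[R]_n) (P : 'M[R]_d.+1) : Prop :=
  idempotent_basis A E /\ forall i, A i = \sum_l P l i *: E l.

(* Seeding the iterated maximum with F ord0, one of the values, makes it the
   maximum of F with no spurious default. *)
Definition max_ord (R : realType) (d : nat) (F : 'I_d.+1 -> R) : R :=
  \big[Num.max/F ord0]_l F l.

(* Main.v *)
Require Import Defs.
From mathcomp Require Import all_boot all_order all_algebra.
From mathcomp Require Import all_classical all_reals.

Set Implicit Arguments.
Unset Strict Implicit.
Unset Printing Implicit Defensive.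

Import Order.TTheory GRing.Theory Num.Theory.
Local Open Scope ring_scope.

(* Since the graphs are regular, (L + K)/2 = ((k1 + k2) I + A2 - A1)/2, and
   A2 - A1 = sum_l (P_l2 - P_l1) E_l.  The E_l are positive semidefinite and sum
   to I, so <E_l, M> are nonnegative weights of total tr M = |V|, which gives the
   upper bound.  The matrices of the scheme have constant diagonal, so a maximal
   term l is attained at the multiple of E_l with unit diagonal. *)

(** * Edge sums and Laplacians of regular graphs *)

(** As [G] is symmetric and loopless, swapping coordinates matches the increasing orientations of
    the edges with the decreasing ones. This turns the edge sums in $L$ and $K$ into sums over
    ordered pairs. *)
Lemma sum_oriented_edges (V : finType) (G : sgraph V) (W : nmodType)
    (F : V * V -> W) :
  \sum_(p : V * V | G p.1 p.2 && (enum_rank p.1 < enum_rank p.2)%N)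
    (F p + F (p.2, p.1)) = \sum_(p : V * V | G p.1 p.2) F p.
Proof.
rewrite big_split /= [RHS](bigID (fun p => (enum_rank p.1 < enum_rank p.2)%N)) /=.
congr (_ + _).
have swapK : involutive (fun p : V * V => (p.2, p.1)) by case.
rewrite [RHS](reindex_inj (inv_inj swapK)) /=; apply: eq_bigl => -[u v] /=.
rewrite (adj_sym G v u); case: (eqVneq u v) => [->|uv]; first by rewrite adj_irr.
congr (_ && _); rewrite -leqNgt ltn_neqAle.
by rewrite (inj_eq val_inj) (inj_eq enum_rank_inj) uv.
Qed.

Section Laplacians.
Context {R : realType} {V : finType}.
Implicit Type G : sgraph V.

Lemma evec_mul (u v : V) :
  evec R u *m (evec R v)^T = delta_mx (enum_rank u) (enum_rank v).
Proof. by rewrite /evec trmx_delta mul_delta_mx. Qed.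

Lemma adjmx_sum_delta G :
  adjmx R G =
  \sum_(p : V * V | G p.1 p.2) delta_mx (enum_rank p.1) (enum_rank p.2).
Proof.
have rankV := onW_bij predT (@enum_rank_bij V).
rewrite -(pair_big_dep xpredT (fun u v => G u v)
  (fun u v => delta_mx (enum_rank u) (enum_rank v))) /=.
rewrite [LHS]matrix_sum_delta (reindex _ rankV); apply: eq_bigr => u _.
rewrite (reindex _ rankV) [RHS]big_mkcond; apply: eq_bigr => v _.
by rewrite mxE !enum_rankK; case: (G u v); rewrite ?scale1r ?scale0r.
Qed.

Lemma degree_sum_delta G k : regular G k ->
  \sum_(p : V * V | G p.1 p.2) delta_mx (enum_rank p.1) (enum_rank p.1)
  = k%:R%:M :> 'M[R]_#|V|.
Proof.
move=> Gk; have rankV := onW_bij predT (@enum_rank_bij V).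
rewrite -(pair_big_dep xpredT (fun u v => G u v)
  (fun u _ => delta_mx (enum_rank u) (enum_rank u))) /=.
rewrite scalar_mx_sum_delta (reindex _ rankV); apply: eq_bigr => u _.
rewrite sumr_const scaler_nat; congr (_ *+ _).
by rewrite -(Gk u); apply: eq_card.
Qed.

(** With $e_{uv}=e_ue_v^T$, the summand $(e_u-e_v)(e_u-e_v)^T$ is $e_{uu}-e_{uv}$ plus its image
    under $u\leftrightarrow v$, so [sum_oriented_edges] applies. *)
Lemma laplacian_regular G k : regular G k ->
  laplacian R G = k%:R%:M - adjmx R G.
Proof.
move=> Gk; rewrite -(degree_sum_delta Gk) adjmx_sum_delta -sumrB.
rewrite -sum_oriented_edges; apply: eq_bigr => p _ /=.
by rewrite linearB mulmxBl !mulmxBr !evec_mul opprB.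
Qed.

Lemma signless_laplacian_regular G k : regular G k ->
  signless_laplacian R G = k%:R%:M + adjmx R G.
Proof.
move=> Gk; rewrite -(degree_sum_delta Gk) adjmx_sum_delta -big_split /=.
rewrite -sum_oriented_edges; apply: eq_bigr => p _ /=.
by rewrite linearD mulmxDl !mulmxDr !evec_mul; congr (_ + _); rewrite addrC.
Qed.
End Laplacians.

(** * Maxima, and coordinates in the span of a scheme *)

(** The element [m] makes [S] nonempty and also bounds it, so [sup] does not take its default
    value. *)
Lemma is_max_sup (R : realType) (S : set R) (m : R) : is_max S m -> sup S = m.
Proof.
move=> [Sm mS]; apply/eqP; rewrite eq_le; apply/andP; split.
  by apply: ge_sup; [exists m | move=> s /mS].
by apply: ub_le_sup => //; exists m => s /mS.
Qed.

Lemma max_ord_ge (R : realType) (d : nat) (F : 'I_d.+1 -> R) l :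
  F l <= max_ord F.
Proof. exact: le_bigmax. Qed.

Lemma max_ord_attained (R : realType) (d : nat) (F : 'I_d.+1 -> R) :
  exists l, max_ord F = F l.
Proof.
rewrite /max_ord; apply: (big_ind (fun x => exists l, x = F l)).
- by exists ord0.
- by move=> x y [i ->] [j ->]; case: leP => _; [exists j | exists i].
- by move=> i _; exists i.
Qed.

Lemma scheme_spanP (R : realType) (n d : nat) (A : 'I_d.+1 -> 'M[R]_n) X :
  X \in scheme_span A -> exists c : 'I_d.+1 -> R, X = \sum_i c i *: A i.
Proof.
rewrite /scheme_span span_def big_image /= => /memv_sumP[v vA ->].
have cP i : exists k, v i = k *: A i by apply/vlineP/vA.
by exists (fun i => sval (cid (cP i))); apply: eq_bigr => i _; case: cid.
Qed.

Lemma mem_scheme_span (R : realType) (n d : nat) (A : 'I_d.+1 -> 'M[R]_n)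
    (c : 'I_d.+1 -> R) : \sum_i c i *: A i \in scheme_span A.
Proof.
by apply: memv_suml => i _; apply/memvZ/memv_span/mapP; exists i; rewrite ?mem_enum.
Qed.

(** * Gram matrices and positive semidefiniteness *)

(** The [i]-th diagonal entry is the squared norm of column [i] of [X]. *)
Lemma gram_diag_eq0 (R : realType) (n : nat) (X : 'M[R]_n) :
  (forall i, (X^T *m X) i i = 0) -> X = 0.
Proof.
move=> X0; apply/matrixP => i j; rewrite mxE.
have := X0 j; rewrite mxE => /psumr_eq0P XX0; apply/eqP.
rewrite -sqrf_eq0 expr2; have := XX0 _ i isT; rewrite mxE => -> // k _.
by rewrite mxE -expr2 sqr_ge0.
Qed.

Lemma psd_gram (R : realType) (n : nat) (X : 'M[R]_n) : psd (X^T *m X).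
Proof.
split=> [|x]; first by rewrite trmx_mul trmxK.
rewrite -!mulmxA mulmxA -trmx_mul mxE sumr_ge0 // => k _.
by rewrite mxE -expr2 sqr_ge0.
Qed.

(** By cyclicity the inner product is $\operatorname{tr}(XMX^T)$, whose diagonal entries are values
    of the quadratic form of [M] at the rows of [X]. *)
Lemma mxinner_gram_psd_ge0 (R : realType) (n : nat) (X M : 'M[R]_n) :
  psd M -> 0 <= mxinner (X^T *m X) M.
Proof.
move=> [Msym Mpos]; rewrite /mxinner Msym -mulmxA mxtrace_mulC.
rewrite sumr_ge0 // => i _.
have -> : (X *m M *m X^T) i i = ((row i X)^T^T *m M *m (row i X)^T) 0 0.
  by rewrite trmxK -row_mul !mxE; apply: eq_bigr => k _; rewrite !mxE.
exact: Mpos.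
Qed.

Lemma mxtrace_unit_diag (R : realType) (n : nat) (M : 'M[R]_n) :
  (forall i, M i i = 1) -> \tr M = n%:R.
Proof.
by move=> M1; rewrite /mxtrace (eq_bigr _ (fun i _ => M1 i)) sumr_const card_ord.
Qed.

Lemma psdZ (R : realType) (n : nat) (a : R) (M : 'M[R]_n) :
  0 <= a -> psd M -> psd (a *: M).
Proof.
move=> a0 [Msym Mpos]; split=> [|x]; first by rewrite linearZ /= Msym.
by rewrite -scalemxAr -scalemxAl mxE mulr_ge0.
Qed.

(** * The algebra spanned by the scheme and its primitive idempotents *)

Section Scheme.
Context {R : realType} {n d : nat} {A E : 'I_d.+1 -> 'M[R]_n} {P : 'M[R]_d.+1}.
Hypotheses (hA : assoc_scheme A) (hP : first_eigenmatrix A E P).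

Lemma scheme_span_sym X : X \in scheme_span A -> X^T = X.
Proof using hA.
move=> /scheme_spanP[c ->]; rewrite linear_sum; apply: eq_bigr => i _.
by rewrite linearZ /= (scheme_sym hA).
Qed.

Lemma scheme_span_mul X Y :
  X \in scheme_span A -> Y \in scheme_span A -> X *m Y \in scheme_span A.
Proof using hA.
move=> /scheme_spanP[a ->] /scheme_spanP[b ->].
have [p pP] := scheme_mul hA.
rewrite mulmx_suml memv_suml // => i _; rewrite mulmx_sumr memv_suml // => j _.
by rewrite -scalemxAl -scalemxAr !memvZ // pP mem_scheme_span.
Qed.

(** The product lies in the span, hence is symmetric: $XY=(XY)^T=YX$. *)
Lemma scheme_span_comm X Y :
  X \in scheme_span A -> Y \in scheme_span A -> X *m Y = Y *m X.
Proof using hA.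
move=> XA YA; rewrite -[LHS]scheme_span_sym ?scheme_span_mul //.
by rewrite trmx_mul !scheme_span_sym.
Qed.

(** The diagonal of $J$ is already exhausted by $A_0=I$, so the other $A_i$, having nonnegative
    entries, vanish on the diagonal. Only the coefficient of $A_0$ remains there. *)
Lemma scheme_span_diag X : X \in scheme_span A ->
  exists c, forall x, X x x = c.
Proof using hA.
move=> /scheme_spanP[c ->]; exists (c ord0) => x.
have A0 : A ord0 x x = 1 by rewrite (scheme_id hA) mxE eqxx.
have /matrixP/(_ x x) := scheme_sum hA.
rewrite mxE summxE big_ord_recl A0 => /(canRL (addKr _)); rewrite addNr.
move=> /psumr_eq0P S0.
rewrite summxE big_ord_recl mxE A0 mulr1 big1 ?addr0 // => i _.
rewrite mxE S0 ?mulr0 // => j _.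
by case: (scheme_01 hA (lift ord0 j) x x) => ->.
Qed.

Lemma idem_mem l : E l \in scheme_span A.
Proof using hP. by have [[_ /(_ l)[[]]]] := hP. Qed.

Lemma idem_mulid l : E l *m E l = E l.
Proof using hP. by have [[_ /(_ l)[[]]]] := hP. Qed.

Lemma idem_neq0 l : E l != 0.
Proof using hP. by have [[_ /(_ l)[]]] := hP. Qed.

(** Symmetry and idempotence present [E l] as a Gram matrix, the source of its positivity below. *)
Lemma idem_gram l : E l = (E l)^T *m E l.
Proof using hA hP. by rewrite scheme_span_sym ?idem_mem // idem_mulid. Qed.

Lemma idem_inj : injective E.
Proof using hP.
have [[/basis_free /free_uniq Euniq _ _] _] := hP.
exact/injectiveP.
Qed.

(* E l splits as E l *m E m plus E l - E l *m E m. *)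
Lemma idem_mul_or l m : E l *m E m = 0 \/ E l *m E m = E l.
Proof using hA hP.
have lm : E l *m E m = E m *m E l by rewrite scheme_span_comm ?idem_mem.
have lml : E l *m E m *m E l = E l *m E m by rewrite -mulmxA -lm mulmxA idem_mulid.
have llm : E l *m (E l *m E m) = E l *m E m by rewrite mulmxA idem_mulid.
have lmlm : E l *m E m *m (E l *m E m) = E l *m E m.
  by rewrite mulmxA lml -mulmxA idem_mulid.
have lmA : E l *m E m \in scheme_span A by rewrite scheme_span_mul ?idem_mem.
have [[_ /(_ l)[_ _ prim] _] _] := hP.
have [||||||/subr0_eq] := prim (E l *m E m) (E l - E l *m E m).
- by [].
- split; first by rewrite rpredB ?idem_mem.
  by rewrite mulmxBl !mulmxBr idem_mulid lml llm lmlm subrr subr0.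
- by rewrite mulmxBr lml lmlm subrr.
- by rewrite mulmxBl llm lmlm subrr.
- by rewrite addrC subrK.
- by left.
- by right.
Qed.

(** By minimality and commutativity, a nonzero product would equal both [E l] and [E m]. *)
Lemma idem_orth l m : l != m -> E l *m E m = 0.
Proof using hA hP.
move=> /eqP lm; case: (idem_mul_or l m) => // El.
case: (idem_mul_or m l); rewrite (scheme_span_comm (idem_mem m) (idem_mem l)) //.
by rewrite El => /idem_inj.
Qed.

Lemma scheme_mul_idem i l : A i *m E l = P l i *: E l.
Proof using hA hP.
have [_ ->] := hP; rewrite mulmx_suml (bigD1 l) //= -scalemxAl idem_mulid.
by rewrite big1 ?addr0 // => m ml; rewrite -scalemxAl idem_orth ?scaler0.
Qed.

(** Multiplying $I=A_0=\sum_m P_{m0}E_m$ by $E_l\neq0$ forces $P_{l0}=1$ for every $l$. *)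
Lemma sum_idem : \sum_l E l = 1%:M.
Proof using hA hP.
rewrite -(scheme_id hA); have [_ ->] := hP; apply: eq_bigr => l _.
have := scheme_mul_idem ord0 l; rewrite (scheme_id hA) mul1mx => /eqP.
rewrite -[X in X == _]scale1r -subr_eq0 -scalerBl scaler_eq0 (negPf (idem_neq0 l)).
by rewrite orbF subr_eq0 => /eqP <-; rewrite scale1r.
Qed.

(** The constant is nonnegative since [E l] is a Gram matrix; a zero diagonal would force [E l] to
    vanish. *)
Lemma idem_diag l : exists2 c, 0 < c & forall x, E l x x = c.
Proof using hA hP.
have [c Ec] := scheme_span_diag (idem_mem l); exists c => //.
case: (pickP (fun x => E l x x != 0)) => [x|Ex0].
  rewrite lt0r Ec => ->; rewrite -(Ec x) idem_gram mxE sumr_ge0 // => k _.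
  by rewrite mxE -expr2 sqr_ge0.
case/eqP: (idem_neq0 l); apply: gram_diag_eq0 => x.
by rewrite -idem_gram; apply/eqP/negbFE/Ex0.
Qed.

End Scheme.

(** * Evaluation of the semidefinite program *)

Theorem theorem7 (R : realType) (V : finType) (G1 G2 : sgraph V)
    (d : nat) (hd : (2 <= d)%N)
    (A E : 'I_d.+1 -> 'M[R]_#|V|) (P : 'M[R]_d.+1)
    (hA : assoc_scheme A)
    (hA1 : A (inord 1) = adjmx R G1)
    (hA2 : A (inord 2) = adjmx R G2)
    (hP : first_eigenmatrix A E P)
    (k1 k2 : nat) (hk1 : regular G1 k1) (hk2 : regular G2 k2) :
  is_max (gamma_values G1 G2) (gamma R G1 G2) /\
  gamma R G1 G2 =
    #|V|%:R / 2 * ((k1 + k2)%:R +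
      max_ord (fun l => P l (inord 2) - P l (inord 1))).
Proof.
set F := fun l => _; set g := _ / 2 * _.
(* The unit diagonal fixes $\operatorname{tr}M=|V|$, so the scalar part of $L+K$ contributes a
   constant and only $A_2-A_1$ varies. *)
have innerE (M : 'M[R]_#|V|) : (forall i, M i i = 1) ->
    mxinner (2^-1 *: (laplacian R G1 + signless_laplacian R G2)) M =
    2^-1 * (#|V|%:R * (k1 + k2)%:R + mxinner (A (inord 2) - A (inord 1)) M).
  move=> M1; have trM := mxtrace_unit_diag M1.
  rewrite (laplacian_regular hk1) (signless_laplacian_regular hk2) -hA1 -hA2.
  rewrite addrACA -raddfD -natrD [- _ + _]addrC /mxinner -scalemxAl mxtraceZ.
  rewrite /= mulmxDl mxtraceD mul_scalar_mx mxtraceZ mxtrace_tr trM.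
  by rewrite [_ * #|V|%:R]mulrC.
have diffE M : mxinner (A (inord 2) - A (inord 1)) M =
    \sum_l F l * mxinner (E l) M.
  have [_ AE] := hP; rewrite /mxinner !AE -sumrB mulmx_suml raddf_sum.
  by apply: eq_bigr => l _; rewrite -scalerBl -scalemxAl /= mxtraceZ.
have gE : g = 2^-1 * (#|V|%:R * (k1 + k2)%:R + max_ord F * #|V|%:R).
  by rewrite /g [#|V|%:R / 2]mulrC -mulrA mulrDr [max_ord F * _]mulrC.
suff gmax : is_max (gamma_values G1 G2) g.
  by rewrite /gamma (is_max_sup gmax).
split.
  have [l Fl] := max_ord_attained F.
  have [c c0 Ec] := idem_diag hA hP l.
  have M1 x : (c^-1 *: E l) x x = 1 by rewrite mxE Ec mulVf ?gt_eqF.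
  exists (c^-1 *: E l); split=> //.
    apply: psdZ; first by rewrite invr_ge0 ltW.
    by rewrite (idem_gram hA hP); apply: psd_gram.
  (* Orthogonality kills every term but the [l]-th, where $\langle
     E_l,c^{-1}E_l\rangle=\operatorname{tr}(c^{-1}E_l)=|V|$. *)
  rewrite innerE // diffE gE Fl (bigD1 l) //= big1 => [|m ml].
    rewrite addr0 -(mxtrace_unit_diag M1) /mxinner [(_ *: _)^T]linearZ /=.
    by rewrite -scalemxAr (scheme_span_sym hA (idem_mem hP l)) (idem_mulid hP).
  rewrite /mxinner [(_ *: _)^T]linearZ /= (scheme_span_sym hA (idem_mem hP l)).
  by rewrite -scalemxAr (idem_orth hA hP ml) scaler0 mxtrace0 mulr0.
move=> _ [M [Mpsd M1 ->]]; rewrite innerE // gE ler_pM2l ?invr_gt0 ?ltr0n //.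
(* Writing $|V|=\operatorname{tr}M=\sum_l\langle E_l,M\rangle$ reduces the bound to a termwise
   comparison. *)
rewrite lerD2l diffE -(mxtrace_unit_diag M1) -[\tr M]mxtrace_tr -[M^T]mul1mx.
rewrite -(sum_idem hA hP) mulmx_suml raddf_sum mulr_sumr.
apply: ler_sum => l _; apply: ler_wpM2r; last exact: max_ord_ge.
by rewrite (idem_gram hA hP l); apply: mxinner_gram_psd_ge0.
Qed.
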